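(* Let $\bm{C}_1,\bm{C}_2\subset\mathbb{P}^3(\mathbb{R})$ be two rational algebraic curves properly parametrized by homogeneous parametrizations $\bm{p},\bm{q}$ of the same degree $n\ge4$, satisfying hypotheses (i)-(iv) listed in the context. Then $\bm{C}_1,\bm{C}_2$ are projectively equivalent if and only if there exists a Möbius transformation $\varphi$ such that $$I_i(\bm{p})=I_i(\bm{q}\circ\varphi)\qquad\text{for } i\in\{1,2,3,4\}.$$
   Context: A curve $\bm{C}\subset\mathbb{P}^3(\mathbb{R})$ is given by a homogeneous parametrization $\bm{p}:\mathbb{P}^1(\mathbb{R})\to\bm{C}$, $\bm{p}(t_0,t_1)=(p_0,p_1,p_2,p_3)$ (a column vector), whose components are real homogeneous polynomials of degree $n$ in $t_0,t_1$. Hypotheses on $\bm{p},\bm{q}$: (i) $\bm{p}$ and $\bm{q}$ are proper, i.e. birational onto $\bm{C}_1$, $\bm{C}_2$ (almost all points of each curve are reached); (ii) $\gcd(p_0,p_1,p_2,p_3)=\gcd(q_0,q_1,q_2,q_3)=1$; (iii) $\bm{p}$ and $\bm{q}$ have the same degree $n\ge 4$; (iv) neither curve is contained in a hyperplane (so the $4\times(n+1)$ coefficient matrices have rank 4). A projectivity is a map $f:\mathbb{P}^3(\mathbb{R})\to\mathbb{P}^3(\mathbb{R})$, $f(\bm{x})=M\cdot\bm{x}$, with $M$ a non-singular real $4\times4$ matrix. $\bm{C}_1,\bm{C}_2$ are projectively equivalent if there is a projectivity $f$ with $f(\bm{C}_1)=\bm{C}_2$. A Möbius transformation is a map $\varphi(t_0,t_1)=(at_0+bt_1,ct_0+dt_1)$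 with $a,b,c,d\in\mathbb{R}$, $ad-bc\ne0$. Notation: $\bm{u}_{t_0^kt_1^l}=\partial^{k+l}\bm{u}/\partial t_0^k\partial t_1^l$; $\Vert\bm{w}_1\,\ldots\,\bm{w}_4\Vert$ is the determinant of the matrix with columns $\bm{w}_i$. Put $$\Delta(\bm{u})=\Vert \bm{u}_{t_0}\,\bm{u}_{t_1}\,\bm{u}_{t_0^2}\,\bm{u}_{t_0^3}\Vert,\quad A_1(\bm{u})=\Vert \bm{u}_{t_0^4}\,\bm{u}_{t_1}\,\bm{u}_{t_0^2}\,\bm{u}_{t_0^3}\Vert,\quad A_2(\bm{u})=\Vert \bm{u}_{t_0}\,\bm{u}_{t_0^4}\,\bm{u}_{t_0^2}\,\bm{u}_{t_0^3}\Vert,$$ $$A_3(\bm{u})=\Vert \bm{u}_{t_0}\,\bm{u}_{t_1}\,\bm{u}_{t_0^4}\,\bm{u}_{t_0^3}\Vert,\quad A_4(\bm{u})=\Vert \bm{u}_{t_0}\,\bm{u}_{t_1}\,\bm{u}_{t_0^2}\,\bm{u}_{t_0^4}\Vert,\quad I_i(\bm{u})=A_i(\bm{u})/\Delta(\bm{u})\ (i=1,2,3,4),$$ which are rational functions of $(t_0,t_1)$. The equalities are identities of rational functions in $t_0,t_1$. *)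

(* Defs.v *)
From HB Require Import structures.
From mathcomp Require Import all_boot all_order all_algebra.
From mathcomp Require Import mpoly.
From mathcomp Require Import boolp classical_sets functions cardinality reals.

Set Implicit Arguments.
Unset Strict Implicit.
Unset Printing Implicit Defensive.

Import GRing.Theory.

Local Open Scope classical_set_scope.
Local Open Scope ring_scope.

(* The projective space P^m(R): its points are the lines of R^(m+1). *)
Definition pspace (R : realType) (m : nat) : Type :=
  {l : {vspace 'cV[R]_m.+1} | \dim l == 1%N}.

Lemma projectivity_subproof (R : realType) (m : nat) (M : 'M[R]_m.+1)
    (hM : M \in unitmx) (x : pspace R m) :
  \dim (linfun (mulmx M) @: val x)%VS == 1%N.
Proof.
rewrite limg_dim_eq ?(eqP (valP x)) //.
apply/eqP; rewrite -subv0; apply/subvP => v.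
rewrite memv_cap memv_ker lfunE /= memv0 => /andP[_ /eqP Mv0].
by rewrite -(mulKmx hM v) Mv0 mulmx0.
Qed.

Definition projectivity (R : realType) (m : nat) (M : 'M[R]_m.+1)
    (hM : M \in unitmx) (x : pspace R m) : pspace R m :=
  exist _ (linfun (mulmx M) @: val x)%VS (projectivity_subproof hM x).

Definition projectively_equivalent (R : realType) (C1 C2 : set (pspace R 3)) :=
  exists (M : 'M[R]_4) (hM : M \in unitmx), projectivity hM @` C1 = C2.

Definition poly_at (R : realType) (m : nat) (F : {mpoly R[m]}) (v : 'cV[R]_m) : R :=
  F.@[fun i => v i ord0].

Definition homog_components (R : realType) (m k d : nat)
    (f : 'cV[{mpoly R[m]}]_k) : Prop :=
  forall i, f i ord0 \is d.-homog.

(* [rat_map f x y]: the rational map with homogeneous components f (all of the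
   same degree) is defined at x and sends x to y.  As y is a line, f(v) is not
   zero; the choice of the vector v representing x is immaterial. *)
Definition rat_map (R : realType) (m k : nat) (f : 'cV[{mpoly R[m.+1]}]_k.+1)
    (x : pspace R m) (y : pspace R k) : Prop :=
  exists2 v : 'cV[R]_m.+1, val x = <[v]>%VS
    & val y = <[map_mx (fun F => poly_at F v) f]>%VS.

Definition vanishes_at (R : realType) (m : nat) (F : {mpoly R[m.+1]})
    (x : pspace R m) : Prop :=
  forall v, v \in val x -> poly_at F v = 0.

Definition zariski_closure (R : realType) (m : nat) (S : set (pspace R m)) :
    set (pspace R m) :=
  [set x | forall (d : nat) (F : {mpoly R[m.+1]}), F \is d.-homog ->
     (forall y, S y -> vanishes_at F y) -> vanishes_at F x].

(* The algebraic curve parametrized by p: the image p(P^1(R)) is in general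
   only dense in it (finitely many real points may not be attained). *)
Definition parametrizes (R : realType) (p : 'cV[{mpoly R[2]}]_4)
    (C : set (pspace R 3)) : Prop :=
  C = zariski_closure [set x | exists t : pspace R 1, rat_map p t x].

(* p is birational onto C: some rational map g is inverse to it, each composite
   being defined and the identity outside finitely many points. *)
Definition birational_onto (R : realType) (p : 'cV[{mpoly R[2]}]_4)
    (C : set (pspace R 3)) : Prop :=
  exists (e : nat) (g : 'cV[{mpoly R[4]}]_2),
    [/\ homog_components e g,
        finite_set [set t : pspace R 1 |
          ~ exists x, [/\ C x, rat_map p t x & rat_map g x t]]
      & finite_set [set x : pspace R 3 |
          C x /\ ~ exists t, rat_map g x t /\ rat_map p t x]].

Definition gcd_one (R : realType) (p : 'cV[{mpoly R[2]}]_4) : Prop :=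
  forall d : {mpoly R[2]},
    (forall i, exists e : {mpoly R[2]}, p i ord0 = e * d) ->
    exists e : {mpoly R[2]}, 1 = e * d.

Definition in_hyperplane (R : realType) (C : set (pspace R 3)) : Prop :=
  exists2 a : 'rV[R]_4, a != 0 &
    forall x, C x -> forall v, v \in val x -> a *m v = 0.

(* The map (t0, t1) |-> (a t0 + b t1, c t0 + d t1), where t0 and t1 are the
   variables of index ord0 and ord_max. *)
Definition moebius (R : realType) (a b c d : R) : 2.-tuple {mpoly R[2]} :=
  [tuple a *: 'X_ord0 + b *: 'X_ord_max; c *: 'X_ord0 + d *: 'X_ord_max].

Definition reparametrize (R : realType) (u : 'cV[{mpoly R[2]}]_4)
    (phi : 2.-tuple {mpoly R[2]}) : 'cV[{mpoly R[2]}]_4 :=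
  map_mx (fun f => f \mPo phi) u.

Section Invariants.

Variables (R : realType).
Implicit Types u w : 'cV[{mpoly R[2]}]_4.

(* [dt0 k u] is the k-th partial derivative of u with respect to t0. *)
Definition dt0 (k : nat) u := iter k (map_mx (mderiv ord0)) u.

Definition dt1 u := map_mx (mderiv ord_max) u.

Definition det_cols w1 w2 w3 w4 : {mpoly R[2]} :=
  \det (\matrix_(i < 4, j < 4) tnth [tuple w1; w2; w3; w4] j i ord0).

Definition Delta u := det_cols (dt0 1 u) (dt1 u) (dt0 2 u) (dt0 3 u).
Definition A1 u := det_cols (dt0 4 u) (dt1 u) (dt0 2 u) (dt0 3 u).
Definition A2 u := det_cols (dt0 1 u) (dt0 4 u) (dt0 2 u) (dt0 3 u).
Definition A3 u := det_cols (dt0 1 u) (dt1 u) (dt0 4 u) (dt0 3 u).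
Definition A4 u := det_cols (dt0 1 u) (dt1 u) (dt0 2 u) (dt0 4 u).

(* The index i ranges over 0, 1, 2, 3 instead of 1, 2, 3, 4. *)
Definition proj_invariant (i : 'I_4) u : {fraction {mpoly R[2]}} :=
  tofrac (tnth [tuple A1 u; A2 u; A3 u; A4 u] i) / tofrac (Delta u).

End Invariants.

(* Main.v *)
Require Import Defs.
From HB Require Import structures.
From mathcomp Require Import all_boot all_order all_algebra.
From mathcomp Require Import mpoly.
From mathcomp Require Import boolp classical_sets functions cardinality reals.
From mathcomp Require Import ring.

Set Implicit Arguments.
Unset Strict Implicit.
Unset Printing Implicit Defensive.

Import Order.TTheory GRing.Theory Num.Theory.

Local Open Scope classical_set_scope.
Local Open Scope ring_scope.

(** Write t1 = 1, so that a form of degree n becomes a polynomial in one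
    variable X and a parametrization becomes a vector of four polynomials.

    Equal invariants give a projectivity.  By Euler's formula the derivative
    along t1 becomes n y - X y', so up to the factor n (and a sign) Delta
    becomes the Wronskian of the four components.  It does not vanish, because
    the curve lies in no hyperplane ([dehomog_Delta_neq0]).  Cramer's rule then
    expresses the fourth derivative of a parametrization in the columns of
    Delta, the coefficients being exactly the I_i: the components of p solve
    a linear differential equation of order four determined by the invariants
    ([parametrization_ode]).  If the invariants of u = q o phi are the same, the
    components of u solve the same equation.  An equation of order four has at
    most four independent polynomial solutions ([ode_dependent]), so u = N p for
    a constant matrix N, invertible because the components of u are independent
    too ([eq_invariants_mulmx]).  Since phi permutes the points of the projective
    line, the projectivity of N maps the image of p onto the image of q, hence
    the one Zariski closure onto the other.

    A projectivity gives equal invariants.  Let M map C1 onto C2 and let g be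
    a rational inverse of q.  Then H = g o (M p) is a pair of polynomials with
    q o H proportional to M p at all but finitely many parameters
    ([generic_lift]).  After division by the greatest common divisor of its
    entries, H becomes a coprime pair (a, b).  Substituting a coprime pair into the coprime
    forms q_i yields coprime polynomials ([subst_unimodular]), so M p and q(a, b)
    differ by a constant factor only.  Comparing degrees, n = n * max(deg a, deg b),
    so a and b have degree at most one and, being coprime, form a Moebius
    transformation phi ([proportional_moebius]).  Hence
    q o phi = N p for an invertible constant matrix N; each A_i and Delta
    is multiplied by det N and the quotients I_i stay the same
    ([proj_invariant_mulmx]). *)

Local Notation constmx A := (map_mx (@mpolyC 2 _) A).

(** * Polynomials vanishing almost everywhere *)

Lemma poly_vanishing (F : numDomainType) (f : {poly F}) :
  (forall s, f.[s] = 0) -> f = 0.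
Proof.
move=> f0; apply: (@roots_geq_poly_eq0 _ _ [seq i%:R | i <- iota 0 (size f)]).
- by apply/allP => s _; rewrite /root f0.
- by rewrite map_inj_uniq ?iota_uniq // => i j /eqP; rewrite eqr_nat => /eqP.
- by rewrite size_map size_iota.
Qed.

Lemma poly_cofinite_vanishing (F : numDomainType) (f : {poly F}) (B : set F) :
  finite_set B -> (forall s, ~ B s -> f.[s] = 0) -> f = 0.
Proof.
move=> /finite_seqP[rs ->] f0.
have : \prod_(r <- rs) ('X - r%:P) * f = 0.
  apply: poly_vanishing => s; rewrite hornerM.
  have [srs|/negP/f0 ->] := boolP (s \in rs); last by rewrite mulr0.
  by move: srs; rewrite -root_prod_XsubC => /rootP ->; rewrite mul0r.
by move/eqP; rewrite mulf_eq0 (negPf (monic_neq0 (monic_prod_XsubC _ _ _))) => /eqP.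
Qed.

(** * Linear differential equations with polynomial coefficients *)

Section Ode.
Variable F : numFieldType.
Implicit Types (y : {poly F}) (c : nat -> {poly F}).

(** Differentiating an equation raises its order by one and keeps the leading
    coefficient; a point where that coefficient is nonzero therefore stays
    regular for all the derived equations. *)
Lemma deriv_ode K c y : \sum_(j < K.+1) c j * y^`(j) = 0 ->
  exists2 c', c' K.+1 = c K & \sum_(j < K.+2) c' j * y^`(j) = 0.
Proof.
move=> /(congr1 (@deriv F)); rewrite raddf_sum raddf0 /= => ode.
exists (fun j => (c j)^`() *+ (j < K.+1) + c j.-1 *+ (0 < j)); first by rewrite ltnn add0r.
rewrite -[RHS]ode; under eq_bigr do rewrite mulrDl.
rewrite big_split /= big_ord_recr /= ltnn mul0r addr0.
rewrite [X in _ + X]big_ord_recl /= mul0r add0r -big_split /=.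
by apply: eq_bigr => j _; rewrite derivM ltn_ord.
Qed.

(** At a regular point each further derivative of a solution is determined by
    the lower ones, so a solution whose initial data vanish has a zero jet. *)
Lemma ode_zero_jet l K c y (t : F) : \sum_(j < K.+1) c j * y^`(j) = 0 ->
  (c K).[t] != 0 -> (forall j, (j < K)%N -> (y^`(j)).[t] = 0) ->
  forall j, (j < K + l)%N -> (y^`(j)).[t] = 0.
Proof.
elim: l K c => [|l IH] K c ode ct y0; first by rewrite addn0.
have yK : (y^`(K)).[t] = 0.
  move/(congr1 (fun f => f.[t])): ode; rewrite horner_sum horner0 big_ord_recr /=.
  rewrite big1 => [|j _]; last by rewrite hornerM y0 ?mulr0.
  by rewrite add0r hornerM => /eqP; rewrite mulf_eq0 (negPf ct) => /eqP.
have [c' c'K ode'] := deriv_ode ode.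
rewrite addnS -addSn; apply: (IH _ _ ode'); first by rewrite c'K.
by move=> j; rewrite ltnS leq_eqVlt => /predU1P[->|/y0].
Qed.

Lemma zero_jet_poly y (t : F) : (forall j, (y^`(j)).[t] = 0) -> y = 0.
Proof.
move=> y0; apply: poly_vanishing => s.
rewrite -[s](subrK t) addrC nderiv_taylor; last exact: mulrC.
rewrite big1 // => i _.
suff -> : y^`N(i).[t] = 0 by rewrite mul0r.
have := y0 i; rewrite nderivn_def hornerMn => /eqP.
by rewrite mulrn_eq0 eqn0Ngt fact_gt0 => /eqP.
Qed.

(** Polynomial solutions of an equation of order at most K form a space of
    dimension at most K: at a regular point t, the m > K vectors of initial data
    (y(t), y'(t), ...) are linearly dependent, and the corresponding combination
    of solutions has zero jet at t.  For K = m - 1 this contains the fact that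
    independent polynomials have a nonzero Wronskian.  Any nontrivial c is
    admitted, as c K may vanish in the applications. *)
Lemma ode_dependent K m c (f : 'cV[{poly F}]_m) :
  (K < m)%N -> (exists2 j, (j <= K)%N & c j != 0) ->
  (forall i, \sum_(j < K.+1) c j * (f i 0)^`(j) = 0) ->
  exists2 a : 'rV[F]_m, a != 0 & map_mx polyC a *m f = 0.
Proof.
move=> Km [j0 j0K cj0] ode.
(* K' is the true order of the equation. *)
have {j0 j0K cj0} [K' [K'm cK] ode'] : exists2 K', [/\ (K' < m)%N & c K' != 0] &
    forall i, \sum_(j < K'.+1) c j * (f i 0)^`(j) = 0.
  elim: K Km j0K ode => [|K IH] Km j0K ode.
    by exists 0%N => //; split=> //; move: j0K cj0; rewrite leqn0 => /eqP ->.
  have [cK|cK] := eqVneq (c K.+1) 0; last by exists K.+1.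
  apply: IH; first exact: ltnW.
    by rewrite -ltnS ltn_neqAle j0K andbT; apply: contraNneq cj0 => ->; rewrite cK.
  by move=> i; have := ode i; rewrite big_ord_recr /= cK mul0r addr0.
have [t ct] : exists t, (c K').[t] != 0.
  apply/not_existsP => H; case/negP: cK; apply/eqP/poly_vanishing => t.
  by apply/eqP; rewrite -[_ == _]negbK; apply/negP.
pose J := \matrix_(i < m, j < K') ((f i 0)^`(j)).[t].
have [a a0 aJ] : exists2 a : 'rV[F]_m, a != 0 & a *m J = 0.
  have : kermx J != 0.
    rewrite kermx_eq0 /row_free neq_ltn; apply/orP; left.
    exact: leq_ltn_trans (rank_leq_col _) K'm.
  by case/rowV0Pn => a /sub_kermxP aJ a0; exists a.
exists a => //; apply/matrixP => i j; rewrite !ord1 !mxE.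
under eq_bigr do rewrite mxE mul_polyC.
set y := \sum_ _ _.
have yj k : y^`(k) = \sum_l a 0 l *: (f l 0)^`(k).
  by rewrite linear_sum; apply: eq_bigr => l _; rewrite linearZ.
apply: (@zero_jet_poly _ t) => k.
apply: (@ode_zero_jet k.+1 K' c) => //; last by rewrite addnS ltnS leq_addl.
  under eq_bigr do rewrite yj mulr_sumr.
  rewrite exchange_big big1 //= => l _.
  by under eq_bigr do rewrite -scalerAr; rewrite -scaler_sumr ode' scaler0.
move=> k' k'K; have /matrixP/(_ 0 (Ordinal k'K)) := aJ; rewrite !mxE => <-.
rewrite yj horner_sum; apply: eq_bigr => l _.
by rewrite hornerZ !mxE.
Qed.

End Ode.

(** * Unimodular polynomial vectors *)

Section Bezout.
Variable F : fieldType.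

(** The ideal generated by finitely many polynomials over a field is principal;
    the generator c *m f is the greatest common divisor of the entries. *)
Lemma poly_bezout k (f : 'cV[{poly F}]_k) :
  exists c : 'rV[{poly F}]_k, forall i, (c *m f) 0 0 %| f i 0.
Proof.
elim: k f => [|k IH] f; first by exists 0; case.
have [c dvdc] := IH (\col_i f (lift 0 i) 0).
set D := (c *m _) 0 0 in dvdc.
have [u /eqpP[[x y] /andP[/= x0 y0] uE]] := Bezoutp (f 0 0) D.
have dvdg : u.1 * f 0 0 + u.2 * D %| gcdp (f 0 0) D.
  by rewrite -(dvdpZr _ _ y0) -uE dvdpZr.
exists (\row_i if unlift 0 i is Some j then u.2 * c 0 j else u.1) => i.
rewrite !mxE big_ord_recl !mxE unlift_none.
under eq_bigr do rewrite mxE liftK -mulrA.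
rewrite -mulr_sumr (_ : \sum_ _ _ = D); last first.
  by rewrite /D mxE; apply: eq_bigr => j _; rewrite mxE.
apply: dvdp_trans dvdg _; case: (unliftP 0 i) => [j ->|->].
  by apply: dvdp_trans (dvdp_gcdr _ _) _; have := dvdc j; rewrite mxE.
exact: dvdp_gcdl.
Qed.

End Bezout.

(** Bezout coefficients replace the cancellation of common factors: if d *m V = 1,
    then U = (d *m U) *: V, and symmetrically, so the two ratios are inverse
    units. *)
Lemma unimodular_vectors_proportional (S : comNzRingType) k (U V : 'cV[S]_k) (c d : 'rV[S]_k) :
  c *m U = 1%:M -> d *m V = 1%:M -> (forall i j, U i 0 * V j 0 = U j 0 * V i 0) ->
  exists l m, l * m = 1 /\ U = l *: V.
Proof.
move=> cU dV UV.
have E (U' V' : 'cV[S]_k) (d' : 'rV[S]_k) : d' *m V' = 1%:M ->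
    (forall i j, U' i 0 * V' j 0 = U' j 0 * V' i 0) ->
    U' = (d' *m U') 0 0 *: V'.
  move=> dV' UV'; apply/colP => i; rewrite !mxE mulr_suml.
  have /matrixP/(_ 0 0) := dV'; rewrite !mxE => /(congr1 (fun s => U' i 0 * s)).
  rewrite mulr1 => <-; rewrite mulr_sumr; apply: eq_bigr => j _.
  by rewrite mulrCA UV' mulrA.
have UE := E _ _ _ dV UV; exists ((d *m U) 0 0), ((c *m V) 0 0); split=> //.
by have := cU; rewrite {1}UE -scalemxAr => /matrixP/(_ 0 0); rewrite !mxE.
Qed.

(** * Binary forms and their dehomogenization *)

Lemma rmorph_mmap m (R S T : nzRingType) (g : {rmorphism S -> T})
    (f : R -> S) (h : 'I_m -> S) (f' : R -> T) (h' : 'I_m -> T) :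
  (forall c, g (f c) = f' c) -> (forall i, g (h i) = h' i) ->
  forall F, g (mmap f h F) = mmap f' h' F.
Proof.
move=> gf gh F; rewrite /mmap rmorph_sum; apply: eq_bigr => k _.
rewrite rmorphM /= gf /mmap1 rmorph_prod; congr (_ * _).
by apply: eq_bigr => i _; rewrite rmorphXn /= gh.
Qed.

Lemma mmap_dhomog_scale m d (R : nzRingType) (S : comNzRingType) (f : R -> S)
    (h h' : 'I_m -> S) c (F : {mpoly R[m]}) :
  F \is d.-homog -> (forall i, h' i = c * h i) ->
  mmap f h' F = c ^+ d * mmap f h F.
Proof.
move=> /dhomogP Fd hc; rewrite /mmap big_seq [in RHS]big_seq mulr_sumr.
apply: eq_bigr => k /Fd /= <-; rewrite mulrCA; congr (_ * _).
rewrite /mmap1 mdegE -prodrXr -big_split /=.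
by apply: eq_bigr => i _; rewrite hc exprMn.
Qed.

Lemma comp_mpoly_dhomog (R : nzRingType) m k d n (phi : m.-tuple {mpoly R[k]})
    (F : {mpoly R[m]}) :
  (forall i, tnth phi i \is d.-homog) -> F \is n.-homog -> F \mPo phi \is (d * n).-homog.
Proof.
move=> phid /dhomogP Fn; rewrite comp_mpolyEX big_seq; apply: rpred_sum => u /Fn /= <-.
apply: rpredZ; rewrite comp_mpolyX mdegE big_distrr /=.
elim/big_rec2: _ => [|i e x _ IH]; first exact: dhomog1.
by apply: dhomogM => //; apply: dhomogMn.
Qed.

Lemma big_ord2 (T : Type) (idx : T) (op : Monoid.law idx) (E : 'I_2 -> T) :
  \big[op/idx]_i E i = op (E ord0) (E ord_max).
Proof.
by rewrite big_ord_recl big_ord1; congr (op _ (E _)); apply: val_inj.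
Qed.

Section Dehomogenization.
Variable R : comNzRingType.
Implicit Types (F G : {mpoly R[2]}) (P Q : {poly R}).

Definition subst_poly m (x : 'cV[{poly R}]_m) (F : {mpoly R[m]}) : {poly R} :=
  mmap polyC (fun i => x i 0) F.

HB.instance Definition _ m (x : 'cV[{poly R}]_m) :=
  GRing.RMorphism.copy (subst_poly x) (mmap polyC (fun i => x i 0)).

Definition affine_line : 'cV[{poly R}]_2 := \col_i (if i == 0 then 'X else 1).

Definition dehomog F := subst_poly affine_line F.
HB.instance Definition _ := GRing.RMorphism.copy dehomog (subst_poly affine_line).

Definition homogenize n P : {mpoly R[2]} :=
  \sum_(j < n.+1) P`_j *: ('X_ord0 ^+ j * 'X_ord_max ^+ (n - j)).

Lemma dehomogZ c F : dehomog (c *: F) = c *: dehomog F.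
Proof. by rewrite /dehomog /subst_poly mmapZ mul_polyC. Qed.

Lemma dehomogX (k : 'X_{1..2}) : dehomog 'X_[k] = 'X^(k ord0).
Proof.
rewrite /dehomog /subst_poly mmapX /mmap1 big_ord2 !mxE /=.
by rewrite expr1n mulr1.
Qed.

Lemma dehomogE F : dehomog F = \sum_(k <- msupp F) F@_k *: 'X^(k ord0).
Proof.
rewrite [in LHS](mpolyE F) rmorph_sum; apply: eq_bigr => k _ /=.
by rewrite dehomogZ dehomogX.
Qed.

Lemma mdeg2 (k : 'X_{1..2}) : mdeg k = (k ord0 + k ord_max)%N.
Proof. by rewrite mdegE big_ord2. Qed.

Lemma mpolyX2 (k : 'X_{1..2}) :
  'X_[k] = 'X_ord0 ^+ k ord0 * 'X_ord_max ^+ k ord_max :> {mpoly R[2]}.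
Proof. by rewrite mpolyXE_id big_ord2. Qed.

Lemma homogenize_is_linear n : linear (homogenize n).
Proof.
move=> c P Q; rewrite /homogenize scaler_sumr -big_split; apply: eq_bigr => j _.
by rewrite coefD coefZ scalerDl scalerA.
Qed.
HB.instance Definition _ n := GRing.isLinear.Build R {poly R} {mpoly R[2]} _
  (homogenize n) (homogenize_is_linear n).

Lemma homogenizeX n j : (j <= n)%N -> homogenize n 'X^j = 'X_ord0 ^+ j * 'X_ord_max ^+ (n - j).
Proof.
rewrite -ltnS => jn; rewrite /homogenize (bigD1 (Ordinal jn)) //= coefXn eqxx scale1r.
rewrite big1 ?addr0 // => i ij; rewrite coefXn; case: eqP => [E|]; last by rewrite scale0r.
by case/eqP: ij; apply: val_inj.
Qed.

Lemma dehomogK n F : F \is n.-homog -> homogenize n (dehomog F) = F.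
Proof.
move=> /dhomogP Fn; rewrite dehomogE linear_sum [RHS](mpolyE F).
rewrite !big_seq; apply: eq_bigr => k /Fn /=; rewrite mdeg2 => kn.
by rewrite linearZ /= homogenizeX -kn ?leq_addr // [(k _ + k _ - _)%N]addKn -mpolyX2.
Qed.

Lemma dehomog_inj n F G :
  F \is n.-homog -> G \is n.-homog -> dehomog F = dehomog G -> F = G.
Proof. by move=> Fn Gn E; rewrite -(dehomogK Fn) -(dehomogK Gn) E. Qed.

Lemma size_dehomog n F : F \is n.-homog -> (size (dehomog F) <= n.+1)%N.
Proof.
move=> /dhomogP Fn; rewrite dehomogE big_seq; apply: (big_ind (fun P => size P <= n.+1)%N).
- by rewrite size_poly0.
- by move=> P Q sP sQ; rewrite (leq_trans (size_polyD _ _)) // geq_max sP.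
move=> k /Fn /=; rewrite mdeg2 => kn; apply: leq_trans (size_scale_leq _ _) _.
by rewrite size_polyXn ltnS -kn leq_addr.
Qed.

Lemma dhomog_monomial n d j F G : (j <= n)%N ->
  F \is d.-homog -> G \is d.-homog -> F ^+ j * G ^+ (n - j) \is (d * n).-homog.
Proof.
by move=> jn Fd Gd; rewrite -{2}(subnKC jn) mulnDr; apply: dhomogM; apply: dhomogMn.
Qed.

Lemma homogenize_dhomog n P : homogenize n P \is n.-homog.
Proof.
apply: rpred_sum => j _; apply: rpredZ.
have jn : (j <= n)%N by rewrite -ltnS.
have X1 i : 'X_i \is [in R[2], 1.-homog] by rewrite dhomogX /= mdeg1.
by have := dhomog_monomial jn (X1 ord0) (X1 ord_max); rewrite mul1n.
Qed.

Lemma homogenizeK n P : (size P <= n.+1)%N -> dehomog (homogenize n P) = P.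
Proof.
move=> sP; rewrite /homogenize rmorph_sum -[RHS](coefK P).
rewrite poly_def (big_ord_widen _ (fun j => P`_j *: 'X^j) sP) [RHS]big_mkcond.
apply: eq_bigr => j _ /=; rewrite dehomogZ rmorphM !rmorphXn /= !dehomogX !mnm1E /=.
rewrite expr1n mulr1; case: ltnP => // sj.
by rewrite nth_default // scale0r.
Qed.

(** Divisors of the dehomogenized forms lift to divisors of the forms through
    this identity. *)
Lemma homogenizeM k l P Q : (size P <= k.+1)%N -> (size Q <= l.+1)%N ->
  homogenize (k + l) (P * Q) = homogenize k P * homogenize l Q.
Proof.
move=> sP sQ; apply: (dehomog_inj (homogenize_dhomog _ _)).
  exact: dhomogM (homogenize_dhomog _ _) (homogenize_dhomog _ _).
rewrite rmorphM /= !homogenizeK //.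
apply: leq_trans (size_polyMleq _ _) _.
by rewrite -ltnS -addnS -addSn; case: (_ + _)%N (leq_add sP sQ) => //=.
Qed.

(** A form is determined by its dehomogenization, and so are all its values, at
    points of any commutative ring. *)
Lemma mmap_dehomog n (S : comNzRingType) (f : {rmorphism R -> S}) (h : 'I_2 -> S) F :
  F \is n.-homog ->
  mmap f h F = \sum_(j < n.+1) f (dehomog F)`_j * (h ord0 ^+ j * h ord_max ^+ (n - j)).
Proof.
move=> Fn; rewrite -[in LHS](dehomogK Fn) {1}/homogenize rmorph_sum; apply: eq_bigr => j _ /=.
by rewrite mmapZ rmorphM !rmorphXn /= !mmapX !mmap1U.
Qed.

Lemma dehomog_deriv0 F : dehomog (mderiv ord0 F) = (dehomog F)^`().
Proof.
rewrite [in LHS](mpolyE F) [in RHS]dehomogE linear_sum rmorph_sum (linear_sum (@deriv R)) /=.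
apply: eq_bigr => k _.
rewrite mderivZ mderivX !dehomogZ dehomogX mnmBE mnm1E eqxx derivZ derivXn subn1.
by rewrite scaler_nat.
Qed.

(** Euler's formula: t0 F_t0 + t1 F_t1 = n F, read at t1 = 1. *)
Lemma dehomog_deriv1 n F : F \is n.-homog ->
  dehomog (mderiv ord_max F) = dehomog F *+ n - 'X * (dehomog F)^`().
Proof.
move=> /dhomogP Fn; rewrite [in LHS](mpolyE F) [in RHS]dehomogE.
rewrite -scaler_nat linear_sum rmorph_sum (linear_sum (@deriv R)) /=.
rewrite mulr_sumr scaler_sumr -sumrB !big_seq.
apply: eq_bigr => k /Fn /=; rewrite mdeg2 => <-.
rewrite mderivZ mderivX !dehomogZ dehomogX mnmBE mnm1E /= subn0 derivZ derivXn.
rewrite -scalerAr [X in X - _]scalerA [_%:R * _]mulrC -scalerA -scalerBr; congr (_ *: _).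
case: (k ord0) => [|j]; first by rewrite mulr0n mulr0 subr0.
by rewrite mulrnAr -exprS -scaler_nat -scalerBl natrD addrAC subrr add0r.
Qed.

Lemma dehomog_comp (phi : 2.-tuple {mpoly R[2]}) F :
  dehomog (F \mPo phi) = subst_poly (\col_i dehomog (tnth phi i)) F.
Proof.
rewrite /comp_mpoly; apply: rmorph_mmap => [c|i]; last by rewrite mxE.
exact: mmapC.
Qed.

End Dehomogenization.

Lemma horner_subst_poly (R : realType) m (x : 'cV[{poly R}]_m) F s :
  (subst_poly x F).[s] = poly_at F (map_mx (horner_eval s) x).
Proof.
rewrite /subst_poly /poly_at /meval.
apply: (rmorph_mmap (g := horner_eval s)) => [c|i].
  by rewrite /= /horner_eval hornerC.
by rewrite mxE.
Qed.

(** * Parametrizations without common factor *)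

Section CommonFactors.
Variable R : realType.
Implicit Types (p q : 'cV[{mpoly R[2]}]_4) (F : {mpoly R[2]}).

Definition col2 (T : Type) (x y : T) : 'cV[T]_2 := \col_i (if i == 0 then x else y).

Lemma col2E (T : Type) (v : 'cV[T]_2) : v = col2 (v 0 0) (v 1 0).
Proof.
apply/colP => i; rewrite mxE; case: i => [[|[|//]] i2] /=; congr (v _ _); exact: val_inj.
Qed.

Lemma map_col2 (T U : Type) (f : T -> U) x y : map_mx f (col2 x y) = col2 (f x) (f y).
Proof. by apply/colP => i; rewrite !mxE; case: ifP. Qed.

Lemma poly_at_col2 n F x y : F \is n.-homog ->
  poly_at F (col2 x y) = \sum_(j < n.+1) (dehomog F)`_j * (x ^+ j * y ^+ (n - j)).
Proof. by move=> Fn; rewrite /poly_at /meval (mmap_dehomog _ _ Fn) !mxE. Qed.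

Lemma subst_poly_col2 n F a b : F \is n.-homog ->
  subst_poly (col2 a b) F = \sum_(j < n.+1) (dehomog F)`_j *: (a ^+ j * b ^+ (n - j)).
Proof.
move=> Fn; rewrite /subst_poly (mmap_dehomog _ _ Fn) !mxE.
by under eq_bigr do rewrite mul_polyC.
Qed.

Lemma poly_at_scale m n (F : {mpoly R[m]}) c v :
  F \is n.-homog -> poly_at F (c *: v) = c ^+ n * poly_at F v.
Proof. by move=> Fn; apply: mmap_dhomog_scale Fn _ => i; rewrite mxE. Qed.

Lemma subst_poly_scale m n (F : {mpoly R[m]}) c x :
  F \is n.-homog -> subst_poly (c *: x) F = c ^+ n * subst_poly x F.
Proof. by move=> Fn; apply: mmap_dhomog_scale Fn _ => i; rewrite mxE. Qed.

Lemma poly_at_affine F s : poly_at F (col2 s 1) = (dehomog F).[s].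
Proof.
by rewrite horner_subst_poly map_col2 /horner_eval hornerX hornerC.
Qed.

Lemma poly_at_infinity n F : F \is n.-homog -> poly_at F (col2 1 0) = (dehomog F)`_n.
Proof.
move=> Fn; rewrite (poly_at_col2 _ _ Fn) big_ord_recr /= big1 => [|j _].
  by rewrite subnn expr1n !mulr1 add0r.
by rewrite expr0n subn_eq0 leqNgt ltn_ord !mulr0.
Qed.

(** A greatest common divisor D of the dehomogenized components has its
    homogenization as a common factor of the forms, hence is a constant. *)
Lemma gcd_one_bezout n p : homog_components n p -> gcd_one p ->
  exists c : 'rV_4, c *m map_mx (@dehomog R) p = 1%:M.
Proof.
move=> pn gp; have [c dvdc] := poly_bezout (map_mx (@dehomog R) p).
set D := (c *m _) 0 0 in dvdc.
have [e eD] : exists e, 1 = e * homogenize (size D).-1 D.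
  apply: gp => i; exists (homogenize (n - (size D).-1) (dehomog (p i 0) %/ D)).
  have [D0|D0] := eqVneq D 0.
    rewrite D0 linear0 mulr0; apply: (dehomog_inj (pn i) (rpred0 _)).
    by have := dvdc i; rewrite D0 dvd0p mxE => /eqP ->; rewrite rmorph0.
  have := dvdc i; rewrite mxE => dvdi.
  have [P0|P0] := eqVneq (dehomog (p i 0)) 0.
    rewrite P0 div0p linear0 mul0r; apply: (dehomog_inj (pn i) (rpred0 _)).
    by rewrite P0 rmorph0.
  have sD : ((size D).-1 <= n)%N.
    by rewrite -ltnS prednK ?size_poly_gt0 // (leq_trans (dvdp_leq P0 dvdi)) // size_dehomog.
  rewrite -homogenizeM ?leqSpred // ?subnK ?divpK //; first exact/esym/dehomogK.
  rewrite size_divp // -subSn //; apply: leq_sub2r; exact: size_dehomog.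
exists (dehomog e *: c); apply/matrixP => i j; rewrite !ord1 -scalemxAl !mxE.
have := congr1 (@dehomog R) eD; rewrite rmorph1 rmorphM /= homogenizeK ?leqSpred //.
by rewrite /D !mxE => <-.
Qed.

(** The dehomogenization does not see the factor t1: if all leading
    coefficients vanished, t1 would divide every component. *)
Lemma gcd_one_infinity n p : homog_components n p -> gcd_one p ->
  exists i, (dehomog (p i 0))`_n != 0.
Proof.
move=> pn gp; apply/not_existsP => H.
have P0 i : (dehomog (p i 0))`_n = 0 by apply/eqP/negPn/negP/H.
have /gp[e] : forall i, exists e, p i 0 = e * 'X_ord_max.
  move=> i; rewrite -[p i 0](dehomogK (pn i)) /homogenize big_ord_recr /= P0 scale0r addr0.
  exists (\sum_(j < n) (dehomog (p i 0))`_j *: ('X_ord0 ^+ j * 'X_ord_max ^+ (n - j).-1)).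
  rewrite mulr_suml; apply: eq_bigr => j _; rewrite -scalerAl -mulrA -exprSr prednK //.
  by rewrite subn_gt0.
move/(congr1 (fun F => poly_at F (col2 1 0))); rewrite /poly_at mevalM meval1 mevalXU !mxE.
by rewrite mulr0 => /eqP; rewrite oner_eq0.
Qed.

(** A common zero at infinity contradicts [gcd_one_infinity], and a finite one
    the Bezout relation of [gcd_one_bezout]. *)
Lemma gcd_one_no_zero n p v : homog_components n p -> gcd_one p -> v != 0 ->
  map_mx (fun F => poly_at F v) p != 0.
Proof.
move=> pn gp; apply: contraNneq => p0.
have {}p0 i : poly_at (p i 0) v = 0 by have /colP/(_ i) := p0; rewrite !mxE.
move: p0; rewrite [v]col2E; set x := v 0 0; set y := v 1 0 => p0.
suff [-> ->] : x = 0 /\ y = 0 by apply/eqP/colP => i; rewrite !mxE if_same.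
have y0 : y = 0.
  apply/eqP/negPn/negP => y0; have [c cP] := gcd_one_bezout pn gp.
  have /matrixP/(_ 0 0)/(congr1 (fun f => f.[x / y])) := cP.
  rewrite !mxE horner_sum hornerC big1 => [/esym/eqP|i _]; first by rewrite oner_eq0.
  have := p0 i; rewrite (_ : col2 x y = y *: col2 (x / y) 1); last first.
    by apply/colP => k; rewrite !mxE; case: ifP => _; rewrite ?mulr1 // mulrC divfK.
  rewrite (poly_at_scale _ _ (pn i)) poly_at_affine => /eqP.
  by rewrite mulf_eq0 expf_eq0 (negPf y0) andbF hornerM mxE => /eqP ->; rewrite mulr0.
split=> //; have [i Pn] := gcd_one_infinity pn gp; apply/eqP/negPn/negP => x0.
have := p0 i; rewrite y0 (_ : col2 x 0 = x *: col2 1 0); last first.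
  by apply/colP => k; rewrite !mxE; case: ifP => _; rewrite ?mulr1 ?mulr0.
rewrite (poly_at_scale _ _ (pn i)) (poly_at_infinity (pn i)) => /eqP.
by rewrite mulf_eq0 expf_eq0 (negPf x0) andbF (negPf Pn).
Qed.

Lemma mulmx_homog n (N : 'M[R]_4) p :
  homog_components n p -> homog_components n (constmx N *m p).
Proof.
move=> pn i; rewrite mxE; apply: rpred_sum => j _.
by rewrite mxE mul_mpolyC; apply: rpredZ; apply: pn.
Qed.

Lemma gcd_one_mulmx p (M : 'M[R]_4) : M \in unitmx ->
  gcd_one p -> gcd_one (constmx M *m p).
Proof.
move=> Mu gp d dvd; apply: gp => i.
have {dvd}[e eE] := fin_all_exists dvd.
exists (\sum_k (invmx M i k)%:MP * e k).
have -> : p = constmx (invmx M) *m (constmx M *m p).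
  by rewrite mulmxA -map_mxM mulVmx // map_mx1 mul1mx.
rewrite mxE mulr_suml; apply: eq_bigr => k _.
by rewrite eE mxE mulrA.
Qed.

(** The greatest common divisor D of the q_i(a, b) is prime to b: a common factor
    of D and b divides q_i(a, b) and b, hence the term of q_i(a, b) in a ^+ n,
    whose coefficient is nonzero for some i, whereas a is prime to b.  So b has
    an inverse b' modulo D, and modulo D the q_i(a, b) become, up to the unit
    b' ^+ n, the values at a * b' of the dehomogenized forms.  These generate the
    unit ideal by [gcd_one_bezout], which forces D to be a constant. *)
Lemma subst_unimodular n q a b : homog_components n q -> gcd_one q -> coprimep a b ->
  exists c : 'rV_4, c *m map_mx (subst_poly (col2 a b)) q = 1%:M.
Proof.
move=> qn gq ab; have [c dvdc] := poly_bezout (map_mx (subst_poly (col2 a b)) q).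
set D := (c *m _) 0 0 in dvdc.
have {}dvdc i : D %| subst_poly (col2 a b) (q i 0) by have := dvdc i; rewrite mxE.
have Db : coprimep D b.
  set e := gcdp D b; have [i Qn] := gcd_one_infinity qn gq.
  have : e %| a ^+ n.
    rewrite -(dvdpZr _ _ Qn).
    have := dvdp_trans (dvdp_gcdl D b) (dvdc i).
    rewrite (subst_poly_col2 _ _ (qn i)) big_ord_recr /= subnn mulr1 dvdp_addr //.
    apply: (big_ind (fun f => e %| f)); [exact: dvdp0|exact: dvdp_add|].
    move=> j _; apply: dvdp_trans (dvdp_gcdr D b) _; rewrite -mul_polyC.
    do 2!apply: dvdp_mull; by apply: dvdp_exp; rewrite // subn_gt0.
  move=> /dvdp_gcd_idl/eqp_size; rewrite /coprimep -/e => <-.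
  by apply: coprimep_expr; apply: coprimep_dvdr (dvdp_gcdr _ _) _; rewrite coprimep_sym.
have [[u b'] /= Bz] := Bezout_eq1_coprimepP _ _ Db.
have Dw i : D %| dehomog (q i 0) \Po (a * b').
  have -> : dehomog (q i 0) \Po (a * b') =
      (subst_poly (col2 (a * b') 1) (q i 0) - subst_poly (b' *: col2 a b) (q i 0))
      + b' ^+ n * subst_poly (col2 a b) (q i 0).
    rewrite -(subst_poly_scale _ _ (qn i)) subrK (subst_poly_col2 _ _ (qn i)).
    rewrite comp_polyE.
    rewrite (big_ord_widen _ (fun j => (dehomog (q i 0))`_j *: (a * b') ^+ j)
      (size_dehomog (qn i))) big_mkcond; apply: eq_bigr => j _ /=.
    rewrite expr1n mulr1; case: ltnP => // sj.
    by rewrite nth_default // scale0r.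
  apply: dvdp_add (dvdp_mull _ (dvdc i)).
  rewrite [b' *: _]col2E !mxE /= !(subst_poly_col2 _ _ (qn i)) -sumrB.
  apply: (big_ind (fun f => D %| f)); [exact: dvdp0|exact: dvdp_add|].
  move=> j _; rewrite -scalerBr [b' * a]mulrC -mulrBr -mul_polyC.
  do 2!apply: dvdp_mull.
  rewrite subrXX; apply: dvdp_mulr.
  by rewrite -Bz addrK dvdp_mull.
have [c0 c0Q] := gcd_one_bezout qn gq.
have D1 : D %| 1.
  have /matrixP/(_ 0 0)/(congr1 (fun f => f \Po (a * b'))) := c0Q.
  rewrite !mxE comp_polyC raddf_sum /= polyC1 => <-.
  apply: (big_ind (fun f => D %| f)); [exact: dvdp0|exact: dvdp_add|].
  move=> j _; rewrite rmorphM mxE; exact: (dvdp_mull _ (Dw j)).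
move: D1; rewrite dvdp1 => /size_poly1P[l l0 Dl].
exists (l^-1%:P *: c); apply/matrixP => i j; rewrite !ord1 -scalemxAl [LHS]mxE -/D Dl.
by rewrite -polyCM mulVf // mxE.
Qed.

End CommonFactors.

(** * Substitutions of degree one *)

Section LinearSubstitution.
Variable R : realType.
Implicit Types (p q : 'cV[{mpoly R[2]}]_4) (F : {mpoly R[2]}).

(** F(a, b) is the dehomogenization of the form F(A, B) of degree m n, where A and
    B are the homogenizations of a and b in degree m; its coefficient of degree
    m n is the value of F(A, B) at infinity, that is F(A(1, 0), B(1, 0)). *)
Lemma subst_poly_top n m F (a b : {poly R}) : F \is n.-homog ->
  (size a <= m.+1)%N -> (size b <= m.+1)%N ->
  (size (subst_poly (col2 a b) F) <= (m * n).+1)%N /\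
  (subst_poly (col2 a b) F)`_(m * n) = poly_at F (col2 a`_m b`_m).
Proof.
move=> Fn sa sb; pose phi := [tuple homogenize m a; homogenize m b].
have phiE i : tnth phi i = homogenize m (if i == 0 then a else b).
  by case: i => [[|[|//]] ?].
have -> : subst_poly (col2 a b) F = dehomog (F \mPo phi).
  rewrite dehomog_comp; congr (subst_poly _ F); apply/colP => i; rewrite !mxE phiE.
  by rewrite homogenizeK //; case: ifP.
have Gn : F \mPo phi \is (m * n).-homog.
  by apply: comp_mpoly_dhomog => // i; rewrite phiE homogenize_dhomog.
split; first exact: size_dehomog.
rewrite -(poly_at_infinity Gn) /poly_at comp_mpoly_meval; apply: meval_eq => i.
rewrite phiE -[LHS]/(poly_at _ (col2 1 0)) (poly_at_infinity (homogenize_dhomog _ _)).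
by rewrite homogenizeK ?mxE; case: ifP.
Qed.

Lemma coprimep_dvd_size (a b : {poly R}) : coprimep a b -> a %| b -> size a = 1%N.
Proof. by rewrite /coprimep => /eqP <- /dvdp_gcd_idl/eqp_size. Qed.

Lemma col2_eq0 (x y : R) : (col2 x y == 0) = (x == 0) && (y == 0).
Proof.
apply/eqP/andP => [/colP E|[/eqP -> /eqP ->]].
  by have := E 0; have := E 1; rewrite !mxE /= => -> ->.
by apply/colP => i; rewrite !mxE if_same.
Qed.

Lemma reparametrize_homog n q a b c d : homog_components n q ->
  homog_components n (reparametrize q (moebius a b c d)).
Proof.
move=> qn i; rewrite mxE -[n]mul1n; apply: comp_mpoly_dhomog; last exact: qn.
by case=> [[|[|//]] ?]; apply: rpredD; apply: rpredZ; rewrite dhomogX /= mdeg1.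
Qed.

Lemma dehomog_moebius (a b c d : R) :
  \col_i dehomog (tnth (moebius a b c d) i) = col2 (a *: 'X + b%:P) (c *: 'X + d%:P).
Proof.
apply/colP => i; rewrite !mxE.
by case: i => [[|[|//]] ?] /=; rewrite rmorphD /= !dehomogZ !dehomogX !mnm1E expr0 alg_polyC.
Qed.

Lemma linear_polyE (a : {poly R}) : (size a <= 2)%N -> a = a`_1 *: 'X + (a`_0)%:P.
Proof.
move=> sa; apply/polyP => -[|[|i]]; rewrite coefD coefZ coefX coefC /= ?mulr0 ?mulr1.
- by rewrite add0r.
- by rewrite addr0.
rewrite addr0.
by rewrite nth_default // (leq_trans sa).
Qed.

(** Both sides are unimodular, so the ratio l is a constant.  If a or b had degree
    m > 1, the coefficient of degree m n > n in q(a, b) would vanish, while by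
    [subst_poly_top] it is the value of q at a nonzero vector.  Once a and b
    have degree at most one, a zero determinant would make them proportional,
    against coprimality. *)
Lemma proportional_moebius n p q (a b : {poly R}) : (0 < n)%N ->
  homog_components n p -> homog_components n q -> gcd_one p -> gcd_one q ->
  coprimep a b ->
  (forall i j, dehomog (p i 0) * subst_poly (col2 a b) (q j 0) =
               dehomog (p j 0) * subst_poly (col2 a b) (q i 0)) ->
  exists (l a1 a0 b1 b0 : R), [/\ l != 0, a1 * b0 - a0 * b1 != 0 &
    p = map_mx (fun F => l *: F) (reparametrize q (moebius a1 a0 b1 b0))].
Proof.
move=> n0 pn qn gp gq ab pq.
have [c cP] := gcd_one_bezout pn gp; have [d dV] := subst_unimodular qn gq ab.
have [|l [l' [ll' PE]]] := unimodular_vectors_proportional cP dV.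
  by move=> i j; rewrite !mxE.
have {l' ll' c cP d dV}[l0 l0N0 lE] : exists2 l0 : R, l0 != 0 & l = l0%:P.
  have : l \is a GRing.unit by apply/unitrPr; exists l'.
  rewrite poly_unitE unitfE => /andP[/eqP sl l0]; exists l`_0 => //.
  by apply: size1_polyC; rewrite sl.
have {l lE}PE i : dehomog (p i 0) = l0 *: subst_poly (col2 a b) (q i 0).
  by have /colP/(_ i) := PE; rewrite !mxE lE mul_polyC.
pose m := (maxn (size a) (size b)).-1.
have am : (size a <= m.+1)%N by rewrite (leq_trans (leq_maxl _ (size b))) ?leqSpred.
have bm : (size b <= m.+1)%N by rewrite (leq_trans (leq_maxr (size a) _)) ?leqSpred.
(* m is the larger of the degrees of a and b. *)
have m1 : (m <= 1)%N.
  rewrite leqNgt; apply/negP => m1.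
  have ab0 : col2 a`_m b`_m != 0.
    rewrite col2_eq0 negb_and /m.
    have [sab|sab] := leqP (size a) (size b); rewrite ?(maxn_idPr sab) ?(maxn_idPl (ltnW sab)).
      apply/orP; right; rewrite -lead_coefE lead_coef_eq0 -size_poly_gt0.
      by move: m1; rewrite /m (maxn_idPr sab); case: (size b).
    apply/orP; left; rewrite -lead_coefE lead_coef_eq0 -size_poly_gt0.
    exact: leq_ltn_trans sab.
  case/negP: (gcd_one_no_zero qn gq ab0); apply/eqP/colP => i; rewrite !mxE.
  have [_ <-] := subst_poly_top (qn i) am bm.
  have /(congr1 (fun f : {poly R} => f`_(m * n))) := PE i; rewrite coefZ nth_default.
    by move=> /esym/eqP; rewrite mulf_eq0 (negPf l0N0) => /eqP.
  apply: leq_trans (size_dehomog (pn i)) _.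
  by rewrite -[X in (X < _)%N]mul1n ltn_pmul2r.
have {am} a2 : (size a <= 2)%N by apply: leq_trans am _; rewrite ltnS.
have {bm} b2 : (size b <= 2)%N by apply: leq_trans bm _; rewrite ltnS.
exists l0, a`_1, a`_0, b`_1, b`_0; split=> //; last first.
  have un := reparametrize_homog a`_1 a`_0 b`_1 b`_0 qn.
  apply/colP => i; have := un i; rewrite !mxE => uni.
  apply: (dehomog_inj (pn i)); first exact: rpredZ.
  by rewrite PE dehomogZ dehomog_comp dehomog_moebius -!linear_polyE.
(* Otherwise a and b would be constants, and p would lose its coefficient of
   degree n. *)
have ab1 : (a`_1 != 0) || (b`_1 != 0).
  rewrite -negb_and -col2_eq0; have [i Pn] := gcd_one_infinity pn gp.
  apply: contraNneq Pn => ab0.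
  have [_] := subst_poly_top (qn i) a2 b2; rewrite PE mul1n coefZ => ->.
  rewrite ab0 -[0 : 'cV_2](scale0r 0) (poly_at_scale _ _ (qn i)).
  by rewrite expr0n eqn0Ngt n0 mul0r mulr0.
apply/negP; rewrite subr_eq0 => /eqP det0.
have abE : b`_1 *: a = a`_1 *: b.
  rewrite (linear_polyE a2) (linear_polyE b2) !coefD !coefZ !coefX !coefC /= -!mul_polyC.
  have := congr1 polyC det0; rewrite !polyCM !polyCD => E.
  ring: E.
have size2 (f : {poly R}) : f`_1 != 0 -> size f != 1%N.
  by apply: contraNneq => f1; rewrite nth_default ?f1.
case/orP: ab1 => [a1|b1].
  case/negP: (size2 _ a1); rewrite (coprimep_dvd_size ab) //.
  by rewrite -(dvdpZr _ _ a1) -abE -mul_polyC dvdp_mull.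
case/negP: (size2 _ b1); rewrite coprimep_sym in ab; rewrite (coprimep_dvd_size ab) //.
by rewrite -(dvdpZr _ _ b1) abE -mul_polyC dvdp_mull.
Qed.

End LinearSubstitution.

(** * Cramer's rule *)

(** The adjugate applied to w has as entries the expansions, along the replaced
    column, of the determinants in which w replaces a column of W. *)
Lemma cramer_relation (S : comNzRingType) (m : nat) (W : 'M[S]_m) (w : 'cV[S]_m) :
  \det W *: w =
  \sum_i \det (\matrix_(k, j) if j == i then w k 0 else W k j) *: col i W.
Proof.
have -> : \det W *: w = W *m (\adj W *m w).
  by rewrite mulmxA mul_mx_adj mul_scalar_mx.
apply/colP => k; rewrite !mxE summxE; apply: eq_bigr => i _.
rewrite !mxE mulrC; congr (_ * _).
rewrite (expand_det_col _ i); apply: eq_bigr => l _.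
rewrite !mxE eqxx mulrC; congr (_ * _).
rewrite /cofactor; congr (_ * \det _).
by apply/matrixP => a b; rewrite !mxE eq_sym (negPf (neq_lift _ _)).
Qed.

Lemma big_ord4 (T : nmodType) (E : 'I_4 -> T) :
  \sum_i E i = E 0 + E 1 + E 2 + E 3.
Proof.
rewrite !big_ord_recl big_ord0 addr0 !addrA.
by congr (_ + E _ + E _ + E _); apply: val_inj.
Qed.

Definition cols4 (T : Type) (w1 w2 w3 w4 : 'cV[T]_4) : 'M[T]_4 :=
  \matrix_(i < 4, j < 4) tnth [tuple w1; w2; w3; w4] j i ord0.

Lemma det_cols4_eq0 (S : idomainType) (w1 w2 w3 w4 : 'cV[S]_4) :
  \det (cols4 w1 w2 w3 w4) = 0 ->
  exists2 v : 'rV[S]_4, v != 0 &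
    forall i, v 0 0 * w1 i 0 + v 0 1 * w2 i 0 + v 0 2 * w3 i 0 + v 0 3 * w4 i 0 = 0.
Proof.
rewrite -det_tr => /eqP/det0P[v v0 vW]; exists v => // i.
by have /matrixP/(_ 0 i) := vW; rewrite !mxE big_ord4 !mxE.
Qed.

Lemma map_cols4 (T U : Type) (f : T -> U) (w1 w2 w3 w4 : 'cV[T]_4) :
  map_mx f (cols4 w1 w2 w3 w4) =
  cols4 (map_mx f w1) (map_mx f w2) (map_mx f w3) (map_mx f w4).
Proof.
by apply/matrixP => i j; rewrite !mxE; case: j => [[|[|[|[|//]]]] ?]; rewrite mxE.
Qed.

Lemma mulmx_cols4 (S : pzSemiRingType) (N : 'M[S]_4) (w1 w2 w3 w4 : 'cV[S]_4) :
  N *m cols4 w1 w2 w3 w4 = cols4 (N *m w1) (N *m w2) (N *m w3) (N *m w4).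
Proof.
apply/matrixP => i j; rewrite !mxE.
case: j => [[|[|[|[|//]]]] ?]; rewrite !(tnth_nth 0) mxE /=;
  by apply: eq_bigr => k _; rewrite mxE (tnth_nth 0).
Qed.

Lemma cramer_relation4 (S : comNzRingType) (w1 w2 w3 w4 w : 'cV[S]_4) :
  \det (cols4 w1 w2 w3 w4) *: w =
  \det (cols4 w w2 w3 w4) *: w1 + \det (cols4 w1 w w3 w4) *: w2 +
  \det (cols4 w1 w2 w w4) *: w3 + \det (cols4 w1 w2 w3 w) *: w4.
Proof.
rewrite cramer_relation big_ord4; set W := cols4 _ _ _ _.
have colE i : col i W = tnth [tuple w1; w2; w3; w4] i.
  by apply/matrixP => k j; rewrite [j]ord1 !mxE.
have repE i v1 v2 v3 v4 :
    (forall j : 'I_4, tnth [tuple v1; v2; v3; v4] j =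
       if j == i then w else tnth [tuple w1; w2; w3; w4] j) ->
    \matrix_(k, j) (if j == i then w k 0 else W k j) = cols4 v1 v2 v3 v4.
  by move=> H; apply/matrixP => k j; rewrite !mxE H; case: ifP.
rewrite (repE 0 w w2 w3 w4) ?(repE 1 w1 w w3 w4) ?(repE 2 w1 w2 w w4)
  ?(repE 3 w1 w2 w3 w) ?colE //; by case=> [[|[|[|[|//]]]] ?].
Qed.

(** * The differential invariants *)

Lemma tofrac_div_eq (S : idomainType) (a b c d : S) : b != 0 -> d != 0 ->
  tofrac a / tofrac b = tofrac c / tofrac d -> a * d = c * b.
Proof.
move=> b0 d0 /eqP; rewrite eqr_div ?tofrac_eq0 // -!tofracM tofrac_eq => /eqP.
by [].
Qed.

Lemma tofrac_div_mull (S : idomainType) (l a b : S) : l != 0 ->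
  tofrac (l * a) / tofrac (l * b) = tofrac a / tofrac b.
Proof. by move=> l0; rewrite !tofracM -mulf_div divff ?mul1r // tofrac_eq0. Qed.

Lemma tnth4_rel (T U : Type) (P : T -> U -> Prop) x1 x2 x3 x4 y1 y2 y3 y4 :
  P x1 y1 -> P x2 y2 -> P x3 y3 -> P x4 y4 ->
  forall i, P (tnth [tuple x1; x2; x3; x4] i) (tnth [tuple y1; y2; y3; y4] i).
Proof. by move=> P1 P2 P3 P4 [[|[|[|[|//]]]] ?]. Qed.

Section Invariants.
Variable R : realType.
Implicit Types (p q u : 'cV[{mpoly R[2]}]_4) (F : {mpoly R[2]}).

Definition components_free u := forall a : 'rV[R]_4, constmx a *m u = 0 -> a = 0.

Lemma components_free_dehomog n u (a : 'rV[R]_4) : homog_components n u -> components_free u ->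
  map_mx polyC a *m map_mx (@dehomog R) u = 0 -> a = 0.
Proof.
move=> un nd aU; apply: nd; apply/matrixP => i j; rewrite !ord1.
apply: (@dehomog_inj _ n); rewrite ?mxE ?rpred0 //.
  apply: rpred_sum => k _; rewrite mxE mul_mpolyC; apply: rpredZ; exact: un.
have /matrixP/(_ 0 0) := aU; rewrite !mxE rmorph0 => <-.
rewrite rmorph_sum; apply: eq_bigr => k _.
by rewrite !mxE mul_mpolyC /= dehomogZ mul_polyC.
Qed.

Lemma det_cols_relation (w1 w2 w3 w4 w : 'cV[{mpoly R[2]}]_4) :
  det_cols w1 w2 w3 w4 *: w =
  det_cols w w2 w3 w4 *: w1 + det_cols w1 w w3 w4 *: w2 +
  det_cols w1 w2 w w4 *: w3 + det_cols w1 w2 w3 w *: w4.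
Proof. exact: cramer_relation4. Qed.

Lemma dehomog_dt0 k u i :
  map_mx (@dehomog R) (dt0 k u) i 0 = (dehomog (u i 0))^`(k).
Proof.
elim: k => [|k IH]; first by rewrite mxE.
by rewrite derivnS -IH [map_mx _ (dt0 k u) i 0]mxE -dehomog_deriv0 mxE /dt0 iterS mxE.
Qed.

Lemma dehomog_dt1 n u i : homog_components n u ->
  map_mx (@dehomog R) (dt1 u) i 0 = dehomog (u i 0) *+ n - 'X * (dehomog (u i 0))^`().
Proof. by move=> un; rewrite !mxE (dehomog_deriv1 (un i)). Qed.

(** A zero determinant gives a nontrivial relation between the columns y',
    n y - X y', y'', y''', which is a nontrivial equation of order three with the
    four components as solutions: they would be dependent. *)
Lemma dehomog_Delta_neq0 n u : (0 < n)%N -> homog_components n u -> components_free u ->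
  dehomog (Delta u) != 0.
Proof.
move=> n0 un nd; apply/negP => /eqP; rewrite -det_map_mx map_cols4.
move=> /det_cols4_eq0[v v0 vW].
pose c := nth 0 [:: v 0 1 *+ n; v 0 0 - 'X * v 0 1; v 0 2; v 0 3].
have [|i|a a0 aU] := @ode_dependent R 3 4 c (map_mx (@dehomog R) u) isT.
- apply/not_exists2P => H; have {}H j : (j <= 3)%N -> c j = 0.
    by move=> j3; have [//|/negP/negPn/eqP] := H j.
  have v1 : v 0 1 = 0.
    have /eqP := H 0%N isT; rewrite /c /= -scaler_nat scaler_eq0 pnatr_eq0 eqn0Ngt n0.
    by move/eqP.
  have v2 : v 0 0 = 0 by have := H 1%N isT; rewrite /c /= v1 mulr0 subr0.
  have v3 : v 0 2 = 0 := H 2%N isT.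
  have v4 : v 0 3 = 0 := H 3%N isT.
  case/negP: v0; apply/eqP/rowP => j; rewrite mxE.
  by case: j => [[|[|[|[|//]]]] jlt];
    [rewrite -[RHS]v2|rewrite -[RHS]v1|rewrite -[RHS]v3|rewrite -[RHS]v4];
    congr (v _ _); apply: val_inj.
- have := vW i; rewrite !dehomog_dt0 (dehomog_dt1 _ un) => E.
  rewrite !big_ord_recl big_ord0 mxE /c /= -[RHS]E.
  ring.
by case/negP: a0; apply/eqP; apply: components_free_dehomog un nd aU.
Qed.

(** The differential equation attached to a parametrization, with denominators
    cleared; its coefficients relative to the leading one are the I_i. *)
Lemma parametrization_ode n u i : homog_components n u ->
  let y := dehomog (u i 0) in
  dehomog (Delta u) * y^`(4) =
    dehomog (A1 u) * y^`() + dehomog (A2 u) * (y *+ n - 'X * y^`())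
    + dehomog (A3 u) * y^`(2) + dehomog (A4 u) * y^`(3).
Proof.
move=> un y.
have key D B1 B2 B3 B4 (w w1 w2 w3 w4 : 'cV[{mpoly R[2]}]_4) :
    let U := map_mx (@dehomog R) in
    D *: w = B1 *: w1 + B2 *: w2 + B3 *: w3 + B4 *: w4 ->
    dehomog D * U w i 0 = dehomog B1 * U w1 i 0 + dehomog B2 * U w2 i 0
      + dehomog B3 * U w3 i 0 + dehomog B4 * U w4 i 0.
  by move=> U /colP/(_ i)/(congr1 (@dehomog R)); rewrite !mxE !rmorphD !rmorphM.
have := key _ _ _ _ _ _ _ _ _ _
  (det_cols_relation (dt0 1 u) (dt1 u) (dt0 2 u) (dt0 3 u) (dt0 4 u)).
by rewrite !dehomog_dt0 (dehomog_dt1 _ un).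
Qed.

Lemma proj_invariant_ratio p u i : Delta p != 0 -> Delta u != 0 ->
  proj_invariant i p = proj_invariant i u ->
  tnth [tuple A1 p; A2 p; A3 p; A4 p] i * Delta u =
  tnth [tuple A1 u; A2 u; A3 u; A4 u] i * Delta p.
Proof.
(* A closed term: proof search would try to identify the determinants A_i p and
   A_i u by expanding them. *)
exact (fun Dp Du E => tofrac_div_eq Dp Du E).
Qed.

Lemma dt0_mulmx k (N : 'M[R]_4) u : dt0 k (constmx N *m u) = constmx N *m dt0 k u.
Proof.
elim: k => [//|k IH]; rewrite /dt0 !iterS -!/(dt0 _ _) IH.
apply/colP => i; rewrite !mxE linear_sum; apply: eq_bigr => j _ /=.
by rewrite !mxE mderiv_mulC.
Qed.

Lemma dt1_mulmx (N : 'M[R]_4) u : dt1 (constmx N *m u) = constmx N *m dt1 u.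
Proof.
apply/colP => i; rewrite !mxE linear_sum; apply: eq_bigr => j _ /=.
by rewrite !mxE mderiv_mulC.
Qed.

Lemma det_cols_mulmx (N : 'M[R]_4) w1 w2 w3 w4 :
  det_cols (constmx N *m w1) (constmx N *m w2) (constmx N *m w3) (constmx N *m w4) =
  (\det N)%:MP * det_cols w1 w2 w3 w4.
Proof.
rewrite -det_map_mx -det_mulmx -/(cols4 w1 w2 w3 w4) mulmx_cols4; exact erefl.
Qed.

Lemma proj_invariant_mulmx (N : 'M[R]_4) u i : N \in unitmx ->
  proj_invariant i (constmx N *m u) = proj_invariant i u.
Proof.
rewrite unitmxE unitfE => N0; have N0' : (\det N)%:MP != 0 :> {mpoly R[2]}.
  by rewrite mpolyC_eq0.
have num w1 w2 w3 w4 v1 v2 v3 v4 :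
    tofrac (det_cols (constmx N *m w1) (constmx N *m w2) (constmx N *m w3) (constmx N *m w4)) /
    tofrac (det_cols (constmx N *m v1) (constmx N *m v2) (constmx N *m v3) (constmx N *m v4)) =
    tofrac (det_cols w1 w2 w3 w4) / tofrac (det_cols v1 v2 v3 v4).
  by rewrite !det_cols_mulmx; exact (tofrac_div_mull _ _ N0').
rewrite /proj_invariant /A1 /A2 /A3 /A4 /Delta !dt0_mulmx dt1_mulmx.
exact (tnth4_rel (P := fun x y => tofrac x / _ = tofrac y / _)
  (num _ _ _ _ _ _ _ _) (num _ _ _ _ _ _ _ _) (num _ _ _ _ _ _ _ _)
  (num _ _ _ _ _ _ _ _) i).
Qed.

(** The coefficients of y, y', y'', y''', y'''' in the equation
    d y'''' = b1 y' + b2 (n y - X y') + b3 y'' + b4 y'''. *)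
Definition ode_coef n (d b1 b2 b3 b4 : {poly R}) : nat -> {poly R} :=
  nth 0 [:: - (b2 *+ n); 'X * b2 - b1; - b3; - b4; d].

(** Equal ratios b_i / d and b_i' / d', written without denominators, define the
    same solutions. *)
Lemma ode_transfer n (d b1 b2 b3 b4 d' b1' b2' b3' b4' y : {poly R}) :
  d' != 0 -> b1 * d' = b1' * d -> b2 * d' = b2' * d -> b3 * d' = b3' * d ->
  b4 * d' = b4' * d ->
  d' * y^`(4) = b1' * y^`() + b2' * (y *+ n - 'X * y^`()) + b3' * y^`(2) + b4' * y^`(3) ->
  \sum_(j < 5) ode_coef n d b1 b2 b3 b4 j * y^`(j) = 0.
Proof.
move=> d'0 E1 E2 E3 E4 E; apply: (mulfI d'0); rewrite mulr0.
rewrite !big_ord_recl big_ord0 /ode_coef /=.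
transitivity (d * (d' * y^`(4)) - (b1 * d') * y^`() - (b2 * d') * (y *+ n - 'X * y^`())
              - (b3 * d') * y^`(2) - (b4 * d') * y^`(3)); first by ring.
rewrite E E1 E2 E3 E4; ring.
Qed.

(** Each component of u and the four components of p are five solutions of an
    equation of order four, hence dependent; the coefficient of the component
    of u in the relation is nonzero because those of p are independent. *)
Lemma ode_solutions_mulmx n p u (c : nat -> {poly R}) :
  homog_components n p -> homog_components n u -> components_free p ->
  (exists2 j, (j <= 4)%N & c j != 0) ->
  (forall i, \sum_(j < 5) c j * (dehomog (p i 0))^`(j) = 0) ->
  (forall i, \sum_(j < 5) c j * (dehomog (u i 0))^`(j) = 0) ->
  exists N : 'M[R]_4, u = constmx N *m p.
Proof.
move=> pn un ndp c0 ode_p ode_u.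
have comb i : exists b : 'rV[R]_4, u i 0 = (constmx b *m p) 0 0.
  pose f : 'cV[{poly R}]_5 :=
    \col_k if unlift 0 k is Some j then dehomog (p j 0) else dehomog (u i 0).
  have [k|a a0 aU] := @ode_dependent R 4 5 c f isT c0.
    by rewrite mxE; case: unliftP => [j|] _.
  have E : (a 0 0)%:MP * u i 0 + \sum_j (a 0 (lift 0 j))%:MP * p j 0 = 0.
    apply: (@dehomog_inj _ n); rewrite ?rpred0 //.
      apply: rpredD; rewrite ?mul_mpolyC; first by apply: rpredZ; apply: un.
      by apply: rpred_sum => j _; rewrite mul_mpolyC; apply: rpredZ; apply: pn.
    have /matrixP/(_ 0 0) := aU; rewrite !mxE rmorph0 => <-.
    rewrite [in RHS]big_ord_recl rmorphD rmorph_sum !mxE unlift_none mul_mpolyC /=.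
    rewrite dehomogZ mul_polyC.
    congr (_ + _); apply: eq_bigr => j _.
    by rewrite !mxE liftK mul_mpolyC /= dehomogZ mul_polyC.
  (* Index 0 stands for the component of u, index j.+1 for the j-th one of p. *)
  have a00 : a 0 0 != 0.
    apply: contraNneq a0 => a00; apply/eqP/rowP => k; rewrite mxE.
    have b0 : \row_j a 0 (lift 0 j) = 0 :> 'rV[R]_4.
      apply: ndp; apply/matrixP => k1 k2; rewrite !ord1 !mxE -[RHS]E a00 mul0r add0r.
      by apply: eq_bigr => j _; rewrite !mxE.
    case: (unliftP 0 k) => [j|] -> //.
    by have /rowP/(_ j) := b0; rewrite !mxE.
  exists (\row_j (- (a 0 0)^-1 * a 0 (lift 0 j))); rewrite mxE.
  have -> : u i 0 = - ((a 0 0)^-1)%:MP * (\sum_j (a 0 (lift 0 j))%:MP * p j 0).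
    move/eqP: E; rewrite addrC addr_eq0 => /eqP ->.
    by rewrite mulrNN mulrA -mpolyCM mulVf // mul1r.
  rewrite mulr_sumr; apply: eq_bigr => j _.
  by rewrite !mxE mpolyCM mpolyCN mulrA.
have [B BE] := fin_all_exists comb.
exists (\matrix_(i, j) B i 0 j).
apply/colP => i; rewrite BE !mxE; apply: eq_bigr => j _; by rewrite !mxE.
Qed.

Lemma eq_invariants_mulmx n p u : (0 < n)%N ->
  homog_components n p -> homog_components n u -> components_free p -> components_free u ->
  (forall i, proj_invariant i p = proj_invariant i u) ->
  exists2 N : 'M[R]_4, N \in unitmx & u = constmx N *m p.
Proof.
move=> n0 pn un ndp ndu Ipu.
have Dp := dehomog_Delta_neq0 n0 pn ndp; have Du := dehomog_Delta_neq0 n0 un ndu.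
have neq0 F : dehomog F != 0 -> F != 0 by apply: contraNneq => ->; rewrite rmorph0.
have dehomogM_eq (a b c d : {mpoly R[2]}) : a * b = c * d ->
    dehomog a * dehomog b = dehomog c * dehomog d.
  by move/(congr1 (@dehomog R)); rewrite !rmorphM.
have AE i : dehomog (tnth [tuple A1 p; A2 p; A3 p; A4 p] i) * dehomog (Delta u) =
            dehomog (tnth [tuple A1 u; A2 u; A3 u; A4 u] i) * dehomog (Delta p).
  exact (dehomogM_eq _ _ _ _ (proj_invariant_ratio (neq0 _ Dp) (neq0 _ Du) (Ipu i))).
pose c := ode_coef n (dehomog (Delta p)) (dehomog (A1 p)) (dehomog (A2 p))
                     (dehomog (A3 p)) (dehomog (A4 p)).
have ode_p i : \sum_(j < 5) c j * (dehomog (p i 0))^`(j) = 0.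
  exact (ode_transfer Dp erefl erefl erefl erefl (parametrization_ode i pn)).
have ode_u i : \sum_(j < 5) c j * (dehomog (u i 0))^`(j) = 0.
  exact (ode_transfer Du (AE 0) (AE 1) (AE 2) (AE 3) (parametrization_ode i un)).
have [N uE] := ode_solutions_mulmx pn un ndp (ex_intro2 _ _ 4%N isT Dp) ode_p ode_u.
exists N => //; rewrite -row_free_unit -kermx_eq0; apply/rowV0P => v /sub_kermxP vN.
by apply: ndu; rewrite uE mulmxA -map_mxM vN map_mx0 mul0mx.
Qed.

End Invariants.

(** * Projective spaces and rational maps *)

Lemma finite_inj_image (T U : Type) (A : set T) (B : set U) (f : T -> U) :
  {in A &, injective f} -> f @` A `<=` B -> finite_set B -> finite_set A.
Proof.
by move=> fI fAB finB; rewrite -(eq_finite_set (inj_card_eq fI)); apply: sub_finite_set finB.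
Qed.

Section ProjectiveSpace.
Variable R : realType.

Definition eval_vec m k (f : 'cV[{mpoly R[m]}]_k) (v : 'cV[R]_m) : 'cV[R]_k :=
  map_mx (fun F => poly_at F v) f.

Lemma line_subproof m (v : 'cV[R]_m.+1) : v != 0 -> \dim <[v]>%VS == 1%N.
Proof. by rewrite dim_vline => ->. Qed.

Definition line m (v : 'cV[R]_m.+1) (v0 : v != 0) : pspace R m :=
  exist _ <[v]>%VS (line_subproof v0).

Lemma pspace_line m (x : pspace R m) : exists2 v : 'cV[R]_m.+1, v != 0 & val x = <[v]>%VS.
Proof.
have dx : \dim (val x) = 1%N := eqP (valP x).
have v0 : vpick (val x) != 0 by rewrite vpick0 -dimv_eq0 dx.
exists (vpick (val x)) => //; apply/esym/eqP.
by rewrite eqEdim dim_vline v0 dx -memvE memv_pick.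
Qed.

Lemma vline_eq m (v w : 'cV[R]_m) : v != 0 -> <[v]>%VS = <[w]>%VS ->
  exists2 k, k != 0 & v = k *: w.
Proof.
move=> v0 E; have /vlineP[k vE] : v \in <[w]>%VS by rewrite -E memv_line.
by exists k => //; apply: contraNneq v0 => k0; rewrite vE k0 scale0r.
Qed.

Lemma vline_scale m (k : R) (v : 'cV[R]_m) : k != 0 -> <[k *: v]>%VS = <[v]>%VS.
Proof.
move=> k0; apply/eqP; rewrite eqEsubv -!memvE memvZ ?memv_line //=.
by apply/vlineP; exists k^-1; rewrite scalerA mulVf // scale1r.
Qed.

Lemma line_neq0 m (x : pspace R m) v : val x = <[v]>%VS -> v != 0.
Proof. by move=> xE; have := valP x; rewrite xE dim_vline; case: (v != 0). Qed.

Lemma val_projectivity m (M : 'M[R]_m.+1) (hM : M \in unitmx) x v :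
  val x = <[v]>%VS -> val (projectivity hM x) = <[M *m v]>%VS.
Proof. by move=> /= ->; rewrite limg_line lfunE. Qed.

Lemma projectivityK m (M : 'M[R]_m.+1) (hM : M \in unitmx) (hN : invmx M \in unitmx) :
  cancel (projectivity hN) (projectivity hM).
Proof.
move=> x; apply: val_inj; have [v v0 xE] := pspace_line x.
by rewrite (val_projectivity _ (val_projectivity _ xE)) mulKVmx.
Qed.

Lemma projectivity_inj m (M : 'M[R]_m.+1) (hM : M \in unitmx) :
  injective (projectivity hM).
Proof.
have hN : invmx M \in unitmx by rewrite unitmx_inv.
apply: (@can_inj _ _ _ (projectivity hN)) => x; apply: val_inj.
have [v v0 xE] := pspace_line x.
by rewrite (val_projectivity _ (val_projectivity _ xE)) mulKmx.
Qed.

Lemma eval_vec_scale m k d (f : 'cV[{mpoly R[m]}]_k) c v :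
  homog_components d f -> eval_vec f (c *: v) = c ^+ d *: eval_vec f v.
Proof. by move=> fd; apply/colP => i; rewrite !mxE (poly_at_scale _ _ (fd i)). Qed.

(** The definition of [rat_map] provides one vector on the line x; homogeneity
    allows any other one. *)
Lemma rat_map_val m k d (f : 'cV[{mpoly R[m.+1]}]_k.+1) x y v :
  homog_components d f -> val x = <[v]>%VS -> rat_map f x y ->
  val y = <[eval_vec f v]>%VS.
Proof.
move=> fd xE [w xE' yE]; rewrite xE in xE'.
have [c c0 vE] := vline_eq (line_neq0 xE) xE'.
by rewrite yE vE (eval_vec_scale _ _ fd) vline_scale // expf_neq0.
Qed.

Lemma rat_map_fun m k d (f : 'cV[{mpoly R[m.+1]}]_k.+1) x y y' :
  homog_components d f -> rat_map f x y -> rat_map f x y' -> y = y'.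
Proof.
move=> fd xy xy'; have [v v0 xE] := pspace_line x.
by apply: val_inj; rewrite (rat_map_val fd xE xy) (rat_map_val fd xE xy').
Qed.

Lemma vanishes_atE m d (F : {mpoly R[m.+1]}) x v : F \is d.-homog -> val x = <[v]>%VS ->
  poly_at F v = 0 -> vanishes_at F x.
Proof.
move=> Fd xE Fv w; rewrite xE => /vlineP[c ->].
by rewrite (poly_at_scale _ _ Fd) Fv mulr0.
Qed.

Lemma sub_zariski_closure m (S : set (pspace R m)) : S `<=` zariski_closure S.
Proof. by move=> x Sx d F Fd; apply. Qed.

Definition linear_forms m (M : 'M[R]_m) : m.-tuple {mpoly R[m]} :=
  [tuple \sum_j M i j *: 'X_j | i < m].

Lemma linear_forms_dhomog m (M : 'M[R]_m) i : tnth (linear_forms M) i \is 1.-homog.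
Proof.
rewrite tnth_mktuple; apply: rpred_sum => j _; apply: rpredZ.
by rewrite dhomogX /= mdeg1.
Qed.

Lemma poly_at_linear_forms m (M : 'M[R]_m) F v :
  poly_at (F \mPo linear_forms M) v = poly_at F (M *m v).
Proof.
rewrite /poly_at comp_mpoly_meval; apply: meval_eq => i.
rewrite tnth_mktuple mxE raddf_sum; apply: eq_bigr => j _ /=.
by rewrite mevalZ mevalXU.
Qed.

(** A form vanishing on the transformed set pulls back, by the linear substitution
    M, to a form of the same degree vanishing on S. *)
Lemma projectivity_closure m (M : 'M[R]_m.+1) (hM : M \in unitmx) (S : set (pspace R m)) :
  projectivity hM @` zariski_closure S `<=` zariski_closure (projectivity hM @` S).
Proof.
move=> _ [x Sx <-] d F Fd FS; have [v v0 xE] := pspace_line x.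
apply: (vanishes_atE Fd (val_projectivity hM xE)); rewrite -poly_at_linear_forms.
have Gd : F \mPo linear_forms M \is d.-homog.
  by rewrite -[d]mul1n; apply: comp_mpoly_dhomog => // i; apply: linear_forms_dhomog.
apply: (Sx _ _ Gd); last by rewrite xE memv_line.
move=> y Sy; have [w w0 yE] := pspace_line y; apply: (vanishes_atE Gd yE).
rewrite poly_at_linear_forms; apply: (FS (projectivity hM y)); first by exists y.
by rewrite (val_projectivity hM yE) memv_line.
Qed.

Lemma projectivity_closure_eq m (M : 'M[R]_m.+1) (hM : M \in unitmx) S :
  projectivity hM @` zariski_closure S = zariski_closure (projectivity hM @` S).
Proof.
apply/seteqP; split; first exact: projectivity_closure.
have hN : invmx M \in unitmx by rewrite unitmx_inv.
move=> x Sx; exists (projectivity hN x); last exact: projectivityK.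
have : (projectivity hN @` zariski_closure (projectivity hM @` S)) (projectivity hN x).
  by exists x.
move/projectivity_closure; congr (zariski_closure _ _).
apply/seteqP; split=> [_ [_ [y Sy <-] <-]|y Sy].
  suff -> : projectivity hN (projectivity hM y) = y by [].
  by apply: (@projectivity_inj _ _ hM); rewrite projectivityK.
exists (projectivity hM y); first by exists y.
by apply: (@projectivity_inj _ _ hM); rewrite projectivityK.
Qed.

End ProjectiveSpace.

(** * From equal invariants to a projectivity *)

Section Curves.
Variable R : realType.
Implicit Types (p q u : 'cV[{mpoly R[2]}]_4) (C : set (pspace R 3)).

Definition curve_image p : set (pspace R 3) := [set x | exists t : pspace R 1, rat_map p t x].

Lemma eval_vec_mulmx k (N : 'M[R]_(k, 4)) p v : eval_vec (constmx N *m p) v = N *m eval_vec p v.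
Proof.
apply/colP => i; rewrite !mxE /poly_at raddf_sum; apply: eq_bigr => j _ /=.
by rewrite !mxE mevalM mevalC.
Qed.

(** A linear relation between the components is a form of degree one vanishing
    on the image of p, hence on its closure. *)
Lemma hyperplane_of_relation C p (a : 'rV[R]_4) : parametrizes p C -> a != 0 ->
  (forall v, a *m eval_vec p v = 0) -> in_hyperplane C.
Proof.
move=> -> a0 ap; exists a => // x Cx v xv.
pose F : {mpoly R[4]} := \sum_i a 0 i *: 'X_i.
have F1 : F \is 1.-homog.
  by apply: rpred_sum => i _; apply: rpredZ; rewrite dhomogX /= mdeg1.
have FE w : poly_at F w = (a *m w) 0 0.
  rewrite mxE /poly_at raddf_sum; apply: eq_bigr => i _ /=.
  by rewrite mevalZ mevalXU.
apply/matrixP => i j; rewrite !ord1 [RHS]mxE -FE; apply: (Cx 1%N) => // y [t [w _ yE]].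
by apply: (vanishes_atE F1 yE); rewrite FE -[map_mx _ _]/(eval_vec p w) ap mxE.
Qed.

Definition moebius_act (a b c d : R) (v : 'cV[R]_2) : 'cV[R]_2 :=
  col2 (a * v 0 0 + b * v 1 0) (c * v 0 0 + d * v 1 0).

Lemma moebius_act_inv (a b c d : R) v : a * d - b * c != 0 ->
  let D := a * d - b * c in
  moebius_act a b c d (moebius_act (d / D) (- b / D) (- c / D) (a / D) v) = v.
Proof.
move=> D0 D; rewrite [RHS]col2E; congr col2; rewrite !mxE /=; rewrite /D; field; exact: D0.
Qed.

Lemma eval_reparametrize q a b c d v :
  eval_vec (reparametrize q (moebius a b c d)) v = eval_vec q (moebius_act a b c d v).
Proof.
apply/colP => i; rewrite !mxE /poly_at comp_mpoly_meval; apply: meval_eq => k.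
rewrite (tnth_nth 0) mxE; case: k => [[|[|//]] ?] /=;
  rewrite mevalD !mevalZ !mevalXU; congr (_ * v _ _ + _ * v _ _); exact: val_inj.
Qed.

Lemma moebius_act_eq0 a b c d v : a * d - b * c != 0 ->
  moebius_act a b c d v = 0 -> v = 0.
Proof.
move=> D0 v0.
have /(congr1 (fun w : 'cV_2 => w 0 0)) := v0; have /(congr1 (fun w : 'cV_2 => w 1 0)) := v0.
rewrite !mxE /= => E1 E0.
have h0 : v 0 0 = 0.
  apply: (mulfI D0); rewrite mulr0.
  transitivity (d * (a * v 0 0 + b * v 1 0) - b * (c * v 0 0 + d * v 1 0)); first by ring.
  by rewrite E0 E1 !mulr0 subr0.
have h1 : v 1 0 = 0.
  apply: (mulfI D0); rewrite mulr0.
  transitivity (a * (c * v 0 0 + d * v 1 0) - c * (a * v 0 0 + b * v 1 0)); first by ring.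
  by rewrite E0 E1 !mulr0 subr0.
by rewrite [v]col2E h0 h1; apply/colP => i; rewrite !mxE if_same.
Qed.

Lemma components_free_reparametrize C q a b c d :
  parametrizes q C -> ~ in_hyperplane C -> a * d - b * c != 0 ->
  components_free (reparametrize q (moebius a b c d)).
Proof.
move=> qC nh D0 r ru; apply: contrapT => /eqP r0; apply: nh.
apply: (hyperplane_of_relation qC r0) => w.
rewrite -(moebius_act_inv w D0) -eval_reparametrize.
by rewrite -eval_vec_mulmx ru; apply/colP => i; rewrite !mxE /poly_at meval0.
Qed.

Lemma components_free_curve C p : parametrizes p C -> ~ in_hyperplane C -> components_free p.
Proof.
move=> pC nh r ru; apply: contrapT => /eqP r0; apply: nh.
apply: (hyperplane_of_relation pC r0) => w.
by rewrite -eval_vec_mulmx ru; apply/colP => i; rewrite !mxE /poly_at meval0.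
Qed.

(** The images themselves correspond, before taking closures: the parameter v of
    p goes to the parameter phi(v) of q, and phi is invertible. *)
Lemma curve_image_projectivity p q a b c d (N : 'M[R]_4) (hN : N \in unitmx) :
  a * d - b * c != 0 -> reparametrize q (moebius a b c d) = constmx N *m p ->
  projectivity hN @` curve_image p = curve_image q.
Proof.
move=> D0 uE.
have key v : eval_vec q (moebius_act a b c d v) = N *m eval_vec p v.
  by rewrite -eval_reparametrize uE eval_vec_mulmx.
apply/seteqP; split=> [_ [x [t [v tE xE]] <-]|y [t [w tE yE]]].
  have v0 : moebius_act a b c d v != 0.
    by apply: contraNneq (line_neq0 tE) => /(moebius_act_eq0 D0) ->.
  exists (line v0), (moebius_act a b c d v) => //.
  by rewrite (val_projectivity hN xE) -[map_mx _ q]/(eval_vec q _) key.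
set D := a * d - b * c; pose v := moebius_act (d / D) (- b / D) (- c / D) (a / D) w.
have wE : w = moebius_act a b c d v by rewrite moebius_act_inv.
have v0 : v != 0.
  apply: contraNneq (line_neq0 tE) => v0; apply/eqP; rewrite wE v0.
  by apply/colP => i; rewrite !mxE !mulr0 !addr0 if_same.
have px : eval_vec p v != 0.
  apply: contraNneq (line_neq0 yE) => p0; apply/eqP.
  by rewrite -[map_mx _ q]/(eval_vec q _) wE key p0 mulmx0.
exists (line px); first by exists (line v0), v.
by apply: val_inj; rewrite (val_projectivity hN (erefl _ : val (line px) = _)) -key -wE yE.
Qed.

Lemma eq_invariants_equivalent n C1 C2 p q : (0 < n)%N ->
  homog_components n p -> homog_components n q ->
  parametrizes p C1 -> parametrizes q C2 ->
  ~ in_hyperplane C1 -> ~ in_hyperplane C2 ->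
  (exists a b c d : R, a * d - b * c != 0 /\ forall i : 'I_4,
      proj_invariant i p = proj_invariant i (reparametrize q (moebius a b c d))) ->
  projectively_equivalent C1 C2.
Proof.
move=> n0 pn qn pC qC nh1 nh2 [a [b [c [d [D0 Ipq]]]]].
have [N hN uE] := eq_invariants_mulmx n0 pn (reparametrize_homog _ _ _ _ qn)
  (components_free_curve pC nh1) (components_free_reparametrize qC nh2 D0) Ipq.
exists N, hN; rewrite pC qC projectivity_closure_eq.
exact: congr1 (curve_image_projectivity hN D0 uE).
Qed.

End Curves.

(** * From a projectivity to a Moebius transformation *)

Section Forward.
Variable R : realType.
Implicit Types (p q u : 'cV[{mpoly R[2]}]_4) (C : set (pspace R 3)).

Lemma affine_neq0 (s : R) : col2 s 1 != 0.
Proof. by rewrite col2_eq0 oner_eq0 andbF. Qed.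

Definition affine_point s : pspace R 1 := line (affine_neq0 s).

Lemma affine_point_inj : injective affine_point.
Proof.
move=> s s' /(congr1 val) /= /(vline_eq (affine_neq0 s))[k _ /colP E].
have := E 1; have := E 0; rewrite !mxE /= mulr1 => -> <-.
by rewrite mul1r.
Qed.

(** H is g o (M p), where g is a rational inverse of q.  The parameters to be
    excluded are those at which the rational inverse of p fails, and those
    for which g fails at the point M p(s) of C2.  The former are finitely many; the
    latter too, because p is injective outside the former. *)
Lemma generic_lift n p q C1 C2 (M : 'M[R]_4) (hM : M \in unitmx) :
  homog_components n p -> homog_components n q ->
  parametrizes p C1 -> birational_onto p C1 -> birational_onto q C2 ->
  gcd_one p -> projectivity hM @` C1 = C2 ->
  exists (B : set R) (H : 'cV[{poly R}]_2), finite_set B /\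
    forall s, ~ B s ->
      map_mx (horner_eval s) H != 0 /\
      exists k, eval_vec (constmx M *m p) (col2 s 1) =
                k *: eval_vec q (map_mx (horner_eval s) H).
Proof.
move=> pn qn pC [e1 [g1 [g1e bad1 _]]] [e2 [g2 [g2e _ bad2]]] gp C12.
have px s : eval_vec p (col2 s 1) != 0 := gcd_one_no_zero pn gp (affine_neq0 s).
pose x s : pspace R 3 := line (px s).
have xp s : rat_map p (affine_point s) (x s) by exists (col2 s 1).
have C1x s : C1 (x s) by rewrite pC; apply: sub_zariski_closure; exists (affine_point s).
set E1 := [set t | _] in bad1; set E2 := [set y | _] in bad2.
(* On B2 the parameter s is recovered from x s, so B2 injects into the finite
   exceptional set of C2. *)
pose B1 := [set s | E1 (affine_point s)].
pose B2 := [set s | ~ E1 (affine_point s) /\ E2 (projectivity hM (x s))].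
exists (B1 `|` B2), (map_mx (subst_poly (map_mx (@dehomog R) (constmx M *m p))) g2).
split.
  rewrite finite_setU; split.
    apply: (@finite_inj_image _ _ _ E1 affine_point) => //.
      by move=> s s' _ _; apply: affine_point_inj.
    by move=> _ [s ? <-].
  apply: (@finite_inj_image _ _ _ E2 (fun s => projectivity hM (x s))) => //; last first.
    by move=> _ [s [_ ?] <-].
  move=> s s' /set_mem[/contrapT[y [_ ty yt]] _] /set_mem[/contrapT[y' [_ ty' yt']] _].
  move/projectivity_inj => xs; apply: affine_point_inj.
  rewrite (rat_map_fun pn ty (xp s)) in yt; rewrite (rat_map_fun pn ty' (xp s')) -xs in yt'.
  exact: rat_map_fun g1e yt yt'.
move=> s nB; have nE1 : ~ E1 (affine_point s) by move=> h; apply: nB; left.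
have nE2 : ~ E2 (projectivity hM (x s)) by move=> h; apply: nB; right.
have C2y : C2 (projectivity hM (x s)) by rewrite -C12; exists (x s).
have {nE2} [t [yt ty]] : exists t, rat_map g2 (projectivity hM (x s)) t /\
    rat_map q t (projectivity hM (x s)).
  by apply: contrapT => nt; apply: nE2.
have Pval : map_mx (horner_eval s) (map_mx (@dehomog R) (constmx M *m p)) =
    eval_vec (constmx M *m p) (col2 s 1).
  apply/colP => i; rewrite [LHS]mxE [RHS]mxE poly_at_affine.
  by rewrite [map_mx _ _ i 0]mxE.
have yE : val (projectivity hM (x s)) = <[eval_vec (constmx M *m p) (col2 s 1)]>%VS.
  by rewrite eval_vec_mulmx; apply: val_projectivity.
have tE := rat_map_val g2e yE yt.
have HE : map_mx (horner_eval s)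
    (map_mx (subst_poly (map_mx (@dehomog R) (constmx M *m p))) g2) =
    eval_vec g2 (eval_vec (constmx M *m p) (col2 s 1)).
  by rewrite -Pval; apply/colP => i; rewrite !mxE /horner_eval horner_subst_poly.
rewrite HE; split; first exact: line_neq0 tE.
have [k _ E] := vline_eq (line_neq0 yE) (etrans (esym yE) (rat_map_val qn tE ty)).
by exists k.
Qed.

(** The relation of [generic_lift] holds at all but finitely many parameters, hence
    identically; dividing H by the greatest common divisor of its entries reduces to
    [proportional_moebius]. *)
Lemma projective_equivalence_lift n p q C1 C2 : (0 < n)%N ->
  homog_components n p -> homog_components n q ->
  parametrizes p C1 -> birational_onto p C1 -> birational_onto q C2 ->
  gcd_one p -> gcd_one q -> projectively_equivalent C1 C2 ->
  exists (a b c d : R) (N : 'M[R]_4), [/\ a * d - b * c != 0, N \in unitmx &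
    constmx N *m p = reparametrize q (moebius a b c d)].
Proof.
move=> n0 pn qn pC bp bq gp gq [M [hM C12]].
have [B [H [finB HB]]] := generic_lift pn qn pC bp bq gp C12.
set p' := constmx M *m p in HB.
have p'n : homog_components n p' := mulmx_homog M pn.
have gp' : gcd_one p' := gcd_one_mulmx hM gp.
have H0 : H != 0.
  apply/negP => /eqP H0; have := @poly_cofinite_vanishing _ (1 : {poly R}) _ finB.
  suff h s : ~ B s -> (1 : {poly R}).[s] = 0 by move=> /(_ h)/eqP; rewrite oner_eq0.
  by case/HB; rewrite H0 map_mx0 eqxx.
have pH i j : dehomog (p' i 0) * subst_poly H (q j 0) =
              dehomog (p' j 0) * subst_poly H (q i 0).
  apply/eqP; rewrite -subr_eq0; apply/eqP; apply: (poly_cofinite_vanishing finB) => s.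
  case/HB => _ [k /colP E]; rewrite hornerD hornerN !hornerM -!poly_at_affine !horner_subst_poly.
  have := E i; have := E j; rewrite !mxE => -> ->; ring.
pose d := gcdp (H 0 0) (H 1 0); pose a := H 0 0 %/ d; pose b := H 1 0 %/ d.
have H01 : (H 0 0 != 0) || (H 1 0 != 0).
  rewrite -negb_and; apply: contra H0 => /andP[/eqP h0 /eqP h1].
  by rewrite [H]col2E h0 h1; apply/eqP/colP => i; rewrite !mxE if_same.
have d0 : d != 0 by rewrite gcdp_eq0 negb_and.
have HE : H = d *: col2 a b.
  rewrite [LHS]col2E; apply/colP => i; rewrite !mxE.
  by case: ifP => _; rewrite mulrC divpK // ?dvdp_gcdl ?dvdp_gcdr.
have ab : coprimep a b := coprimep_div_gcd H01.
have pab i j : dehomog (p' i 0) * subst_poly (col2 a b) (q j 0) =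
               dehomog (p' j 0) * subst_poly (col2 a b) (q i 0).
  have := pH i j; rewrite HE !(subst_poly_scale _ _ (qn _)).
  by rewrite !(mulrCA _ (d ^+ n)) => /(mulfI (expf_neq0 n d0)).
have [l [a1 [a0 [b1 [b0 [l0 D0 p'E]]]]]] := proportional_moebius n0 p'n qn gp' gq ab pab.
exists a1, a0, b1, b0, (l^-1 *: M); split=> //.
  by rewrite unitmxZ // unitfE invr_eq0.
apply/colP => i; have /colP/(_ i) := p'E; rewrite [RHS in _ = RHS -> _]mxE => E.
apply: (can_inj (scalerK l0)); rewrite -E.
rewrite /p' !mxE scaler_sumr; apply: eq_bigr => j _.
by rewrite !mxE mpolyCM -!mul_mpolyC !mulrA -mpolyCM divff // mul1r.
Qed.

End Forward.

Theorem theorem7 (R : realType) (n : nat) (C1 C2 : set (pspace R 3))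
    (p q : 'cV[{mpoly R[2]}]_4) :
  (4 <= n)%N ->
  homog_components n p -> homog_components n q ->
  parametrizes p C1 -> parametrizes q C2 ->
  birational_onto p C1 -> birational_onto q C2 ->
  gcd_one p -> gcd_one q ->
  ~ in_hyperplane C1 -> ~ in_hyperplane C2 ->
  projectively_equivalent C1 C2 <->
  exists a b c d : R, a * d - b * c != 0 /\
    forall i : 'I_4,
      proj_invariant i p = proj_invariant i (reparametrize q (moebius a b c d)).
Proof.
move=> n4 pn qn pC qC bp bq gp gq nh1 nh2; have n0 : (0 < n)%N by apply: leq_trans n4.
split; last exact (eq_invariants_equivalent n0 pn qn pC qC nh1 nh2).
move=> C12; have [a [b [c [d [N [D0 hN uE]]]]]] :=
  projective_equivalence_lift n0 pn qn pC bp bq gp gq C12.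
exists a, b, c, d; split; first exact D0.
by move=> i; rewrite -uE; exact (esym (proj_invariant_mulmx p i hN)).
Qed.
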